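(* Let $(n,k,l) \in \mathbb{N}^3$ with $l < k$ and set $m := \lceil \log_2(k-l) \rceil$. Then \[ {\rm Nim}(\mathcal{KG}(n,k,l)) = \left( \binom{n \bmod 2^m}{k \bmod 2^m} \bmod 2 \right) \cdot \left( \binom{\lfloor n/2^m \rfloor}{\lfloor k/2^m \rfloor} \bmod 3 \right). \]
   Context: Chomp on a finite poset $P$ with global minimum $0$: two players alternately pick an element $x$ of the remaining poset and remove all elements $\ge x$; the player forced to pick $0$ loses. The Nim-value is defined recursively by ${\rm Nim}(\{0\})=0$ and ${\rm Nim}(P)=\mathrm{mex}\{{\rm Nim}(P_x) : x\in P\setminus\{0\}\}$, where $P_x$ is $P$ with the up-set of $x$ removed and $\mathrm{mex}$ is the least nonnegative integer not in the set. A finite graph is regarded as the poset consisting of the empty set, its vertices and its edges ordered by inclusion; thus a move removes either an edge, or a vertex together with its incident edges, and a player who cannot move (the graph is empty) loses. For $(n,k,l)\in\mathbb{N}\times\mathbb{Z}^2$, the generalized Kneser graph $\mathcal{KG}(n,k,l)$ has as vertices the $k$-element subsets of $\{1,\dots,n\}$, two distinct vertices being adjacent iff the corresponding sets intersect in at most $l$ elements. Binomial coefficients $\binom{a}{b}$ with $b>a$ are $0$. *)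

(* Defs.v *)
From HB Require Import structures.
From mathcomp Require Import all_boot all_order all_algebra.

Set Implicit Arguments.
Unset Strict Implicit.
Unset Printing Implicit Defensive.

Lemma mex_exists (s : seq nat) : exists i, i \notin s.
Proof.
exists (\max_(i <- s) i).+1; apply/negP => maxS_s.
by have := @leq_bigmax_seq _ s xpredT id _ maxS_s isT; rewrite ltnn.
Qed.

Definition mex (s : seq nat) : nat := ex_minn (mex_exists s).

Section Chomp.

Variables (d : Order.disp_t) (P : finBPOrderType d).

(* A position is the set of remaining elements, with the order induced by P. *)
Definition chomp_move (A : {set P}) (x : P) : {set P} :=
  [set y in A | ~~ (x <= y)%O].

(* Every move removes at least one element, so the recursion is well-founded
   on #|A|; h is a bound on the number of remaining moves (see nim_posE). *)
Fixpoint nim_rec (h : nat) (A : {set P}) : nat :=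
  if h is h'.+1 then
    mex [seq nim_rec h' (chomp_move A x) | x in A :\ (\bot)%O]
  else 0.

Definition nim_pos (A : {set P}) : nat := nim_rec #|A| A.

Definition nim : nat := nim_pos [set: P].

Lemma card_chomp_move (A : {set P}) x : x \in A -> #|chomp_move A x| < #|A|.
Proof.
move=> xA; apply: proper_card; apply/properP; split.
  by apply/subsetP => y; rewrite inE => /andP[].
by exists x => //; rewrite inE Order.POrderTheory.lexx andbF.
Qed.

Lemma nim_rec_eq h (A : {set P}) : #|A| <= h -> nim_rec h A = nim_pos A.
Proof.
rewrite /nim_pos; move: {-2}h (leqnn h) => h' hh'.
elim: h h' hh' A => [|h IHh] [|h'] // hh' A Ah'.
- by move: Ah'; rewrite leqn0 => /eqP ->.
- by move: Ah'; rewrite leqn0 => /eqP ->.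
case cA: #|A| => [|n] /=.
  move/cards0_eq: cA => ->.
  by rewrite set0D /image_mem enum_set0 /mex; case: ex_minnP => -[|i] // _ /(_ 0 isT).
congr mex; apply/eq_in_map => x; rewrite mem_enum => /setD1P[_ xA].
have := card_chomp_move xA; rewrite cA ltnS => lt_n.
have le_nh' : n <= h' by rewrite -ltnS -cA.
have le_nh : n <= h by apply: leq_trans le_nh' _.
by rewrite (IHh h') ?(IHh n) // (leq_trans lt_n).
Qed.

Lemma nim_posE (A : {set P}) :
  nim_pos A = mex [seq nim_pos (chomp_move A x) | x in A :\ (\bot)%O].
Proof.
rewrite -(nim_rec_eq (leqnSn _)) /=; congr mex; apply/eq_in_map => x.
rewrite mem_enum => /setD1P[_ /card_chomp_move /ltnW].
exact: nim_rec_eq.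
Qed.

End Chomp.

Record sgraph := SGraph {
  svertex :> finType;
  sadj : rel svertex;
  sadj_sym : symmetric sadj;
  sadj_irrefl : irreflexive sadj
}.

Section GraphPoset.

Variable G : sgraph.

Definition is_face (F : {set G}) : bool :=
  [|| F == set0,
      [exists x : G, F == [set x]] |
      [exists x : G, exists y : G, sadj x y && (F == [set x; y])]].

Record face := Face { face_set :> {set G}; _ : is_face face_set }.

HB.instance Definition _ := [isSub for face_set].
HB.instance Definition _ := [Finite of face by <:].

Definition face_le (F F' : face) : bool := face_set F \subset face_set F'.

Fact face_le_refl : reflexive face_le.
Proof. by move=> F; apply: subxx. Qed.

Fact face_le_anti : antisymmetric face_le.
Proof.
by move=> F F' FF'; apply/val_inj/eqP; rewrite eqEsubset; apply: FF'.
Qed.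

Fact face_le_trans : transitive face_le.
Proof. by move=> F' F F''; apply: subset_trans. Qed.

Fact face_display : Order.disp_t. Proof. exact: (Order.Disp tt tt). Qed.

HB.instance Definition _ := Order.Le_isPOrder.Build face_display face
  face_le_refl face_le_anti face_le_trans.

Fact is_face0 : is_face set0.
Proof. by rewrite /is_face eqxx. Qed.

Fact face_le0 (F : face) : (Face is_face0 <= F)%O.
Proof. exact: sub0set. Qed.

HB.instance Definition _ := Order.hasBottom.Build face_display face face_le0.

End GraphPoset.

Definition graph_poset (G : sgraph) : finBPOrderType face_display := face G.

Section Kneser.

Variables (n : nat) (k l : int).

Definition kneser_vertex : finType := {A : {set 'I_n} | #|A|%:Z == k}%R.

Definition kneser_adj : rel kneser_vertex :=
  fun A B => (A != B) && (#|val A :&: val B|%:Z <= l)%R.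

Fact kneser_adj_sym : symmetric kneser_adj.
Proof. by move=> A B; rewrite /kneser_adj eq_sym setIC. Qed.

Fact kneser_adj_irrefl : irreflexive kneser_adj.
Proof. by move=> A; rewrite /kneser_adj eqxx. Qed.

Definition kneser : sgraph := SGraph kneser_adj_sym kneser_adj_irrefl.

End Kneser.

(* Main.v *)
Require Import Defs.
From mathcomp Require Import all_boot all_order all_algebra.
From mathcomp Require Import perm zify.

Set Implicit Arguments.
Unset Strict Implicit.
Unset Printing Implicit Defensive.

Import Order.POrderTheory Order.TTheory GRing.Theory.

(** An involution of a poset whose fixed points form a down-set does not change
the Nim-value when one passes to the fixed points. For a graph, the condition is
that no vertex is adjacent to its image. Swapping two disjoint blocks of 2^j
points of {1, ..., n} moves a k-set that is a union of blocks by at most 2^j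
points, so it is admissible while 2^j < k - l, and its fixed sets are those that
are unions of blocks after merging the two. Starting from singletons, one merges
equal blocks until there are floor(n / 2^m) blocks of size 2^m and smaller blocks
of pairwise distinct sizes given by the binary digits of n mod 2^m. Two distinct
unions of blocks of size k then differ by at least 2^m >= k - l points, so the
graph has become complete. Its number of vertices is the number of subsets of the
blocks of total size k, and Nim(K_N) = N mod 3, because removing a vertex of K_N
leaves K_(N-1), while removing an edge leaves a graph in which swapping the
endpoints is admissible, with fixed graph K_(N-2). *)

(** * Characterization of the mex *)

Lemma mex_notin s : mex s \notin s.
Proof. by rewrite /mex; case: ex_minnP. Qed.

Lemma lt_mex s u : u < mex s -> u \in s.
Proof.
rewrite /mex; case: ex_minnP => v _ min_v lt_uv.
by apply: contraLR lt_uv => /min_v; rewrite -leqNgt.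
Qed.

Lemma mex_eq s v : v \notin s -> (forall u, u < v -> u \in s) -> mex s = v.
Proof.
move=> v_s lt_s; case: (ltngtP (mex s) v) => // [/lt_s | /lt_mex].
  by rewrite (negbTE (mex_notin s)).
by rewrite (negbTE v_s).
Qed.

(** * Involutions of posets and Nim-values *)

Section Involution.

Variables (d : Order.disp_t) (P : finBPOrderType d).
Implicit Types (A : {set P}) (x y : P).

Lemma nim_pos_move A x :
  x \in A :\ (\bot)%O -> nim_pos (chomp_move A x) != nim_pos A.
Proof.
move=> xA; apply: contraNneq (mex_notin
  [seq nim_pos (chomp_move A x) | x in A :\ (\bot)%O]) => eqA.
by rewrite -nim_posE -eqA; apply/imageP; exists x.
Qed.

Lemma nim_pos_reach A u : u < nim_pos A ->
  exists2 x, x \in A :\ (\bot)%O & nim_pos (chomp_move A x) = u.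
Proof. by rewrite nim_posE => /lt_mex/imageP[x xA ->]; exists x. Qed.

Lemma nim_pos_eq A v :
    (forall x, x \in A :\ (\bot)%O -> nim_pos (chomp_move A x) != v) ->
    (forall u, u < v ->
      exists2 x, x \in A :\ (\bot)%O & nim_pos (chomp_move A x) = u) ->
  nim_pos A = v.
Proof.
move=> neq_v reach; rewrite nim_posE; apply: mex_eq => [|u /reach[x xA <-]].
  by apply/imageP => -[x /neq_v/eqP neq ?]; apply: neq.
by apply/imageP; exists x.
Qed.

Definition fixed_in (phi : P -> P) A := [set x in A | phi x == x].

(* A move at a non-fixed x is answered by phi x: as the fixed points form a
   down-set, this restores the symmetry without touching them. *)
Lemma nim_pos_involution (phi : P -> P) A :
    {in A, forall x, phi x \in A} -> {in A, involutive phi} ->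
    {in A &, {homo phi : x y / (x <= y)%O}} ->
    {in A &, forall x y, (y <= x)%O -> phi x = x -> phi y = y} ->
  nim_pos A = nim_pos (fixed_in phi A).
Proof.
have [N] := ubnP #|A|; elim: N A => // N IHN A ltAN phiA phiK phi_le phi_fix.
(* The induction hypothesis covers every [phi]-stable proper subset, since the conditions on [phi]
   are inherited by subsets. *)
have sub_inv (B : {set P}) : B \proper A -> {in B, forall x, phi x \in B} ->
  nim_pos B = nim_pos (fixed_in phi B).
- move=> /[dup] /proper_card ltBA /proper_sub /subsetP sBA phiB.
  apply: IHN => //; first by rewrite -ltnS (leq_trans _ ltAN).
  + exact: sub_in1 phiK.
  + exact: sub_in2 phi_le.
  + exact: sub_in2 phi_fix.
have phi_bot x : x \in A -> phi x = (\bot)%O -> x = (\bot)%O.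
  move=> xA eq_bot; apply/eqP; rewrite -lex0.
  have := phi_le _ _ (phiA _ xA) xA; rewrite phiK // eq_bot.
  by apply; apply: le0x.
have proper_move (B : {set P}) x : B \subset A -> x \in B -> chomp_move B x \proper A.
  move=> sBA xB; apply: proper_sub_trans sBA; apply/properP.
  split; first by apply/subsetP => y; rewrite inE => /andP[].
  by exists x => //; rewrite inE lexx andbF.
(* Monotonicity keeps the complement of the up-set of a fixed [x] stable under [phi]. *)
have move_fixed x : x \in A -> phi x = x ->
    nim_pos (chomp_move A x) = nim_pos (chomp_move (fixed_in phi A) x).
  move=> xA fix_x; rewrite sub_inv ?proper_move // => [|y].
    by congr nim_pos; apply/setP => y; rewrite !inE andbAC.
  rewrite !inE => /andP[yA]; rewrite phiA //=; apply: contraNN => le_x_phiy.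
  by have := phi_le _ _ xA (phiA _ yA) le_x_phiy; rewrite fix_x phiK.
(* Smaller values are reached by moves at fixed points; it remains to see that no move, fixed or
   not, leads to the value of the fixed part. *)
apply: nim_pos_eq => [x /setD1P[x0 xA]|u /nim_pos_reach[x]]; last first.
  rewrite !inE => /and3P[x0 xA /eqP fix_x] <-.
  by exists x; rewrite ?move_fixed // !inE x0.
have [fix_x|nfix_x] := eqVneq (phi x) x.
  by rewrite move_fixed // nim_pos_move // !inE x0 xA fix_x eqxx.
(* Otherwise applying [phi] would give the reverse inequality, hence [phi x = x]. So the answer
   [phi x] is still available after [x]. *)
have nle_x_phix : ~~ (x <= phi x)%O.
  apply: contra nfix_x => le_x_phix; rewrite eq_le le_x_phix andbT.
  by have := phi_le _ _ xA (phiA _ xA) le_x_phix; rewrite phiK.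
have phixAx : phi x \in chomp_move A x by rewrite inE phiA.
(* A position never has the value of one of its own options, so it is enough that the answer [phi x]
   leads to the value of the fixed part. No fixed point lies above [x] or [phi x], because fixed
   points form a down-set. *)
suff -> : nim_pos (fixed_in phi A) =
    nim_pos (chomp_move (chomp_move A x) (phi x)).
  rewrite eq_sym nim_pos_move // inE phixAx andbT inE.
  by apply: contra x0 => /eqP/phi_bot->.
rewrite [RHS]sub_inv.
- congr nim_pos; apply/setP => y; rewrite !inE.
  case yA: (y \in A) => //=; case: eqP => [fix_y|_]; last by rewrite andbF.
  rewrite andbT; symmetry; apply/andP; split; apply: contraNN nfix_x => le_y; apply/eqP.
    exact: (phi_fix y).
  by have /esym := phi_fix y (phi x) yA (phiA _ xA) le_y fix_y; rewrite phiK.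
- apply: proper_move => //; by apply/subsetP => y; rewrite inE => /andP[].
move=> y; rewrite !inE -andbA => /and3P[yA nle_xy nle_phixy].
rewrite phiA //=; apply/andP; split.
  apply: contraNN nle_phixy => /(phi_le _ _ xA (phiA _ yA)).
  by rewrite phiK.
apply: contraNN nle_xy => /(phi_le _ _ (phiA _ xA) (phiA _ yA)).
by rewrite !phiK.
Qed.

End Involution.

(** * Chomp on induced subgraphs and cliques *)

Section GraphNim.

Variable G : sgraph.
Implicit Types (S : {set G}) (A : {set graph_poset G}) (s : G -> G).

Definition induced S : {set graph_poset G} := [set F | face_set F \subset S].

(** Adjacency is required only inside [F], so that transpositions of a clique, which need not be
    automorphisms of [G], are covered. *)
Lemma is_face_imset s (F : face G) : injective s ->
    {in F &, forall x y, sadj x y -> sadj (s x) (s y)} ->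
  is_face [set s x | x in face_set F].
Proof.
case: F => F /= faceF inj_s adj_s.
case/or3P: faceF => [/eqP F0|/existsP[x /eqP Fx]|].
- by rewrite F0 imset0 /is_face eqxx.
- by apply/or3P/Or32/existsP; exists (s x); rewrite Fx imset_set1.
case/existsP=> x /existsP[y /andP[adj_xy /eqP Fxy]].
apply/or3P/Or33/existsP; exists (s x); apply/existsP; exists (s y).
by rewrite Fxy imsetU !imset_set1 eqxx andbT adj_s // Fxy !inE eqxx ?orbT.
Qed.

(** Here [s] only has to permute the faces in [A], which allows positions such as a clique with one
    edge removed. As invariant faces are fixed pointwise, they form a down-set in [A]. *)
Lemma nim_pos_graph_involution s A : involutive s ->
    {in A, forall F, exists2 F', F' \in A & face_set F' = s @: face_set F} ->
    {in A, forall F, s @: face_set F = face_set F ->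
      {in face_set F, forall x, s x = x}} ->
  nim_pos A = nim_pos [set F in A | [forall x in face_set F, s x == x]].
Proof.
(* The default value [F] is taken only when the image is not a face, which never happens in [A]. *)
move=> sK sA fix_s; pose phi (F : face G) : face G := insubd F (s @: face_set F).
have phiE F : F \in A -> face_set (phi F) = s @: face_set F.
  move=> /sA[F' _ eqF]; rewrite -[LHS]/(val (phi F)) insubdK //.
  by rewrite -eqF; apply: (valP F').
have phiA F : F \in A -> phi F \in A.
  move=> FA; have [F' F'A eqF] := sA F FA.
  by rewrite (_ : phi F = F') //; apply: val_inj; rewrite /= phiE.
have fixP F : F \in A -> (phi F == F) = [forall x in face_set F, s x == x].
  move=> FA; rewrite -val_eqE /= phiE //; apply/eqP/forall_inP.
    by move=> /(fix_s F FA) fix_F x /fix_F->.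
  move=> fix_F; rewrite -[RHS]imset_id; apply: eq_in_imset => x xF.
  by apply/eqP/fix_F.
rewrite (@nim_pos_involution _ _ phi).
- congr nim_pos; apply/setP => F; rewrite !inE.
  by case FA: (F \in A) => //=; rewrite fixP.
- exact: phiA.
- move=> F FA; apply: val_inj; rewrite /= !phiE ?phiA // -imset_comp.
  by rewrite -[RHS]imset_id; apply: eq_imset => x /=.
- move=> F F' FA F'A; rewrite -![(_ <= _)%O]/(face_le _ _) /face_le !phiE //.
  exact: imsetS.
move=> F F' FA F'A /subsetP sF'F /eqP; rewrite fixP // => /forall_inP fix_F.
by apply/eqP; rewrite fixP //; apply/forall_inP => x /sF'F/fix_F.
Qed.

(** An invariant face that is not fixed pointwise would be an edge from some [x] to [s x], which the
    last condition excludes. *)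
Lemma nim_pos_induced_involution s S : involutive s ->
    {homo s : x y / sadj x y} -> {in S, forall x, s x \in S} ->
    {in S, forall x, ~~ sadj x (s x)} ->
  nim_pos (induced S) = nim_pos (induced [set x in S | s x == x]).
Proof.
move=> sK s_adj sS nadj.
rewrite (@nim_pos_graph_involution s) //.
- congr nim_pos; apply/setP => F; rewrite !inE.
  apply/andP/subsetP => [[/subsetP FS /forall_inP fix_F] x xF|FS].
    by rewrite inE FS ?fix_F.
  split; first by apply/subsetP => x /FS; rewrite inE => /andP[].
  by apply/forall_inP => x /FS; rewrite inE => /andP[].
- move=> F; rewrite inE => /subsetP FS.
  have faceF : is_face (s @: face_set F).
    by apply: is_face_imset => [|x y _ _ /s_adj]; first exact: inv_inj.
  exists (Face faceF) => //; rewrite inE /=.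
  by apply/subsetP => _ /imsetP[x xF ->]; rewrite sS ?FS.
move=> F; rewrite inE => FS eqF x xF.
have sxF : s x \in face_set F by rewrite -eqF imset_f.
have [//|neq] := eqVneq (s x) x.
have := nadj x (subsetP FS x xF); case: F {FS eqF} xF sxF => F /= faceF xF sxF.
case/or3P: faceF => [/eqP F0|/existsP[y /eqP Fy]|].
- by rewrite F0 inE in xF.
- by move: xF sxF neq; rewrite Fy !inE => /eqP-> ->.
case/existsP=> y /existsP[z /andP[adj_yz /eqP Fyz]].
move: xF sxF neq; rewrite Fyz !inE => /orP[]/eqP-> /orP[]/eqP->; rewrite ?eqxx //.
  by rewrite adj_yz.
by rewrite sadj_sym adj_yz.
Qed.

Definition clique S := {in S &, forall x y, x != y -> sadj x y}.

Lemma clique_sub S S' : S' \subset S -> clique S -> clique S'.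
Proof. by move=> /subsetP sub cS x y /sub xS /sub yS; apply: cS. Qed.

Lemma chomp_vertex S x (F : face G) : face_set F = [set x] ->
  chomp_move (induced S) F = induced (S :\ x).
Proof.
move=> Fx; apply/setP => F'; rewrite !inE subsetD1; congr (_ && ~~ _).
by rewrite -[LHS]/(face_set F \subset face_set F') Fx sub1set.
Qed.

(* Once the edge xy is removed, swapping x and y is an admissible symmetry. *)
Lemma chomp_edge S x y (F : face G) : clique S -> x \in S -> y \in S ->
    x != y -> face_set F = [set x; y] ->
  nim_pos (chomp_move (induced S) F) = nim_pos (induced (S :\ x :\ y)).
Proof.
move=> cS xS yS neq_xy Fxy; pose s := tperm x y.
have inA F' : (F' \in chomp_move (induced S) F) =
    (face_set F' \subset S) && ~~ ((x \in face_set F') && (y \in face_set F')).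
  rewrite !inE -[(F <= F')%O]/(face_set F \subset face_set F') Fxy.
  by rewrite subUset !sub1set.
have sS z : z \in S -> s z \in S by rewrite /s; case: tpermP => // ->.
rewrite (@nim_pos_graph_involution s).
- congr nim_pos; apply/setP => F'; rewrite inE inA [in RHS]inE !subsetD1.
  case: (face_set F' \subset S) => //=; apply/andP/andP => -[].
    move=> nxy /forall_inP fix_F'; split; apply/negP => /fix_F'.
      by rewrite tpermL eq_sym (negbTE neq_xy).
    by rewrite tpermR (negbTE neq_xy).
  move=> xF' yF'; rewrite (negbTE xF'); split=> //.
  apply/forall_inP => z zF'; apply/eqP/tpermD.
    by apply: contraNneq xF' => ->.
  by apply: contraNneq yF' => ->.
- exact: tpermK.
- move=> F'; rewrite inA => /andP[/subsetP F'S nxy].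
  have faceF : is_face (s @: face_set F').
    apply: is_face_imset => [|u v uF vF adj_uv]; first exact: perm_inj.
    apply: cS; rewrite ?sS ?F'S // (inj_eq perm_inj).
    by apply: contraTneq adj_uv => ->; rewrite sadj_irrefl.
  exists (Face faceF) => //; rewrite inA /=; apply/andP; split.
    by apply/subsetP => _ /imsetP[z zF ->]; rewrite sS ?F'S.
  have mem_s z : (z \in s @: face_set F') = (s z \in face_set F').
    by rewrite -{1}(tpermK x y z) (mem_imset _ _ perm_inj).
  by rewrite !mem_s tpermL tpermR andbC.
(* An invariant face with a moved point contains both [x] and [y], so it has been removed. *)
move=> F'; rewrite inA => /andP[_ nxy] eqF' z zF'.
have szF' : s z \in face_set F' by rewrite -eqF' imset_f.
move: zF' szF'; rewrite /s; case: tpermP => // -> uF vF; move: nxy;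
  by rewrite uF vF.
Qed.

Lemma nim_pos_clique S : clique S -> nim_pos (induced S) = #|S| %% 3.
Proof.
have [N] := ubnP #|S|; elim: N S => // N IHN S ltSN cS.
have sub1 x : S :\ x \subset S by apply: subD1set.
have nim1 x (F : face G) : x \in S -> face_set F = [set x] ->
    nim_pos (chomp_move (induced S) F) = #|S|.-1 %% 3.
  move=> xS Fx; have := cardsD1 x S; rewrite xS => cardS.
  by rewrite (chomp_vertex S Fx) IHN; [congr (_ %% 3)|..|exact: clique_sub cS]; lia.
have nim2 x y (F : face G) : x \in S -> y \in S -> x != y ->
    face_set F = [set x; y] ->
    nim_pos (chomp_move (induced S) F) = #|S|.-2 %% 3.
  move=> xS yS neq_xy Fxy; rewrite (chomp_edge cS xS yS neq_xy Fxy).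
  have := cardsD1 y (S :\ x); have := cardsD1 x S.
  rewrite xS !inE yS eq_sym neq_xy /= => cardS cardSx.
  rewrite IHN; [congr (_ %% 3); lia|lia|].
  by apply: clique_sub cS; rewrite (subset_trans (subD1set _ _)).
(* With N vertices, the options have the values of N - 1 and, when there is an edge, N - 2 modulo 3;
   both differ from N modulo 3. *)
apply: nim_pos_eq => [F|u lt_u].
  rewrite !inE => /andP[F0 FS].
  case/or3P: (valP F) => [/eqP F_0|/existsP[x /eqP Fx]|].
  - by case/eqP: F0; apply: val_inj.
  - have xS : x \in S by rewrite -sub1set -Fx.
    by rewrite (nim1 x) //; have := cardsD1 x S; rewrite xS; lia.
  case/existsP=> x /existsP[y /andP[adj_xy /eqP Fxy]].
  have neq_xy : x != y by apply: contraTneq adj_xy => ->; rewrite sadj_irrefl.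
  have : [set x; y] \subset S by rewrite -Fxy.
  move=> /[dup] /subset_leq_card; rewrite cards2 neq_xy subUset !sub1set.
  by move=> cardS /andP[xS yS]; rewrite (nim2 x y) //; lia.
have [x xS] : exists x, x \in S by apply/set0Pn; rewrite -card_gt0; lia.
have face_nz (F : face G) : face_set F != set0 -> face_set F \subset S ->
    F \in induced S :\ (\bot)%O.
  by rewrite !inE => F0 ->; rewrite andbT; apply: contra F0 => /eqP->.
have [u1|u_neq1] := eqVneq u (#|S|.-1 %% 3).
  have faceF : is_face [set x].
    by apply/or3P/Or32/existsP; exists x.
  exists (Face faceF); last by rewrite (nim1 x).
  by apply: face_nz; rewrite /= ?sub1set //; apply/set0Pn; exists x; rewrite inE.
(* A second vertex exists: for N = 1 the only value to reach is 0 = N - 1, already treated. *)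
have [y] : exists y, y \in S :\ x.
  by apply/set0Pn; rewrite -card_gt0; have := cardsD1 x S; rewrite xS; lia.
move=> /[dup] ySx; rewrite !inE eq_sym => /andP[neq_xy yS].
have faceF : is_face [set x; y].
  apply/or3P/Or33/existsP; exists x; apply/existsP; exists y.
  by rewrite eqxx andbT cS.
exists (Face faceF); last first.
  rewrite (nim2 x y) //; have := cardsD1 x S; have := cardsD1 y (S :\ x).
  by rewrite xS ySx; lia.
apply: face_nz; rewrite /= ?subUset ?sub1set ?xS //.
by apply/set0Pn; exists x; rewrite !inE eqxx.
Qed.

End GraphNim.

(** * Subset sums of powers of two *)

Section PowerOfTwoWeights.

Variables (T : finType) (e : T -> nat).
Implicit Types D X Y : {set T}.

(** The exponents are distinct and below [m], so the sum is at most 1 + 2 + ... + 2 ^ (m - 1). The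
    induction splits off the element of largest admissible exponent, if present. *)
Lemma sum_pow2_lt D m : {in D &, injective e} -> {in D, forall c, e c < m} ->
  \sum_(c in D) 2 ^ e c < 2 ^ m.
Proof.
elim: m D => [|m IHm] D inj_e lt_em.
  by rewrite big1 // => c /lt_em.
have [/existsP[c /andP[cD /eqP ec]]|/existsPn no_m] :=
    boolP [exists c, (c \in D) && (e c == m)].
  rewrite (bigD1 c) //= ec expnS mul2n -addnn ltn_add2l.
  rewrite (eq_bigl (mem (D :\ c))) => [|x]; last by rewrite !inE andbC.
  apply: IHm => [x y|x] /setD1P[neq_xc xD]; first by move=> /setD1P[_]; apply: inj_e.
  rewrite ltn_neqAle -ltnS lt_em // andbT -ec.
  by apply: contra neq_xc => /eqP/inj_e->.
rewrite (leq_trans (IHm _ inj_e _)) ?leq_exp2l // => c cD.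
by have := no_m c; rewrite cD /= ltn_neqAle => -> /=; rewrite -ltnS lt_em.
Qed.

(* Compare the two sums at the largest exponent in the symmetric difference. *)
Lemma sum_pow2_inj D X Y : {in D &, injective e} -> X \subset D -> Y \subset D ->
  \sum_(c in X) 2 ^ e c = \sum_(c in Y) 2 ^ e c -> X = Y.
Proof.
move=> inj_e sXD sYD eq_sum; apply/eqP/idPn => neqXY.
pose S := (X :\: Y) :|: (Y :\: X).
have [c0 c0S] : exists c0, c0 \in S.
  apply/set0Pn; apply: contra neqXY.
  by rewrite setU_eq0 !setD_eq0 eqEsubset.
have [c cS max_c] := arg_maxnP (P := mem S) e c0S.
wlog cXY: X Y sXD sYD eq_sum neqXY @S c0S cS max_c / c \in X :\: Y => [hwlog|].
  case/setUP: (cS) => [cXY|cYX]; first by apply: (hwlog X Y).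
  by apply: (hwlog Y X); rewrite // 1?eq_sym // setUC.
have eqD : \sum_(c in X :\: Y) 2 ^ e c = \sum_(c in Y :\: X) 2 ^ e c.
  apply/eqP; move/eqP: eq_sum.
  by rewrite (big_setID Y) /= [X in _ == X](big_setID X) /= setIC eqn_add2l.
(* Exponents on [Y :\: X] are at most [e c] by maximality and differ from it by injectivity, so
   their sum is below a single term of the other sum. *)
have: \sum_(c in Y :\: X) 2 ^ e c < 2 ^ e c.
  apply: sum_pow2_lt => [x y|x] xYX.
    move=> /setDP[yY _]; case/setDP: xYX => xY _.
    by apply: inj_e; apply: (subsetP sYD).
  have xS : x \in S by rewrite inE xYX orbT.
  rewrite ltn_neqAle [_ <= _](max_c x xS) andbT; apply/eqP => eq_e.
  have [xY xX] := setDP xYX; have [cX cY] := setDP cXY.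
  suff eq_xc: x = c by move: cY; rewrite -eq_xc xY.
  by apply: inj_e; first exact: (subsetP sYD); first exact: (subsetP sXD).
by rewrite -eqD (big_setD1 c) //= ltnNge leq_addr.
Qed.

Local Open Scope ring_scope.

(* Over F_2, the generating function of the subset sums is
   \prod_c (1 + X ^ 2 ^ e c) = (1 + X) ^ s. *)
Lemma card_subset_sum_mod2 D r :
  #|[set X : {set T} | X \subset D & (\sum_(c in X) 2 ^ e c == r)%N]|
    = 'C(\sum_(c in D) 2 ^ e c, r) %[mod 2].
Proof.
pose p : {poly 'F_2} := \prod_(c in D) ('X^(2 ^ e c) + 1).
have char2 : 2 \in [pchar {poly 'F_2}] by rewrite pchar_poly pchar_Fp.
(* Frobenius turns each factor into a power of ['X + 1]. *)
have pE1 : p = ('X + 1) ^+ (\sum_(c in D) 2 ^ e c)%N.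
  rewrite -prodrXr; apply: eq_bigr => c _.
  by rewrite exprDn_pchar ?expr1n // pnatX pnatE // char2.
have pE2 : p = \sum_(X : {set T} | X \subset D) 'X^(\sum_(c in X) 2 ^ e c).
  rewrite /p big_mkcond /=.
  (* Indices outside [D] get the factor 0 + 1, so that after distributing, every subset not
     contained in [D] contributes 0. *)
  rewrite (eq_bigr (fun c => (if c \in D then 'X^(2 ^ e c) else 0) + 1)); last first.
    by move=> c _; case: ifP; rewrite ?add0r.
  rewrite bigA_distr (bigID (fun X : {set T} => X \subset D)) /=.
  rewrite [X in _ + X]big1 ?addr0 => [|X /subsetPn[c cX cD]]; last first.
    by rewrite (bigD1 c) //= cX (negbTE cD) mul0r.
  apply: eq_bigr => X /subsetP sXD; rewrite -prodrXr [RHS]big_mkcond /=.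
  by apply: eq_bigr => c _; case: ifP => // /sXD ->.
have eq_coef : #|[set X : {set T} | X \subset D & (\sum_(c in X) 2 ^ e c == r)%N]|%:R
    = 'C(\sum_(c in D) 2 ^ e c, r)%:R :> 'F_2.
  transitivity p`_r.
    rewrite pE2 coef_sum -sum1_card natr_sum big_mkcond [RHS]big_mkcond /=.
    apply: eq_bigr => X _; rewrite inE coefXn [r == _]eq_sym.
    by case: (X \subset D); case: eqP.
  rewrite pE1 addrC exprDn coef_sum; set s := (\sum_(c in D) _)%N.
  have [lt_rs|ge_rs] := ltnP r s.+1.
    rewrite (bigD1 (Ordinal lt_rs)) //= expr1n mul1r coefMn coefXn eqxx.
    rewrite big1 ?addr0 // => i neq_i; rewrite expr1n mul1r coefMn coefXn.
    by rewrite [r == i]eq_sym -[r]/(val (Ordinal lt_rs)) val_eqE (negbTE neq_i) mul0rn.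
  rewrite bin_small // big1 // => i _; rewrite expr1n mul1r coefMn coefXn.
  by rewrite gtn_eqF ?mul0rn // (leq_trans (ltn_ord i)).
by have := congr1 val eq_coef; rewrite /= !val_Fp_nat.
Qed.

Local Close Scope ring_scope.

(* The weights 2 ^ m are counted by a binomial coefficient; by uniqueness of
   binary expansions, the pairwise distinct smaller weights contribute at most
   one subset, so that counting it modulo 2 is enough. *)
Lemma card_subset_sum D m k :
    {in D, forall c, e c <= m} ->
    {in D &, forall c c', e c = e c' -> e c < m -> c = c'} ->
  let n := \sum_(c in D) 2 ^ e c in
  #|[set X : {set T} | X \subset D & \sum_(c in X) 2 ^ e c == k]|
    = ('C(n %% 2 ^ m, k %% 2 ^ m) %% 2) * 'C(n %/ 2 ^ m, k %/ 2 ^ m).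
Proof.
move=> le_em inj_e /=.
pose S := [set c in D | e c < m]; pose B := [set c in D | e c == m].
have inj_S : {in S &, injective e}.
  move=> x y; rewrite !inE => /andP[xD lt_x] /andP[yD _] eq_e.
  exact: inj_e.
have pow_m_gt0 : 0 < 2 ^ m by rewrite expn_gt0.
(* This is division by [2 ^ m]: the large weights give the quotient, the small ones the
   remainder. *)
have sum_split X : X \subset D ->
    \sum_(c in X) 2 ^ e c = #|X :&: B| * 2 ^ m + \sum_(c in X :&: S) 2 ^ e c.
  move=> /subsetP sXD; rewrite (bigID (mem B)) /=; congr (_ + _).
    rewrite -sum_nat_const; apply: eq_big => [x|x]; first by rewrite in_setI.
    by rewrite !inE => /andP[_ /andP[_ /eqP->]].
  apply: eq_bigl => x; rewrite !inE; case xX: (x \in X) => //=.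
  by rewrite sXD //= ltn_neqAle le_em ?sXD // andbT.
have sum_S_lt X : \sum_(c in X :&: S) 2 ^ e c < 2 ^ m.
  apply: sum_pow2_lt => [x y /setIP[_ xS] /setIP[_ yS]|x /setIP[_]].
    exact: inj_S.
  by rewrite inE => /andP[].
have sum_div X : X \subset D -> (\sum_(c in X) 2 ^ e c) %/ 2 ^ m = #|X :&: B|.
  by move=> sXD; rewrite sum_split // divnMDl // divn_small ?addn0.
have sum_mod X : X \subset D ->
    (\sum_(c in X) 2 ^ e c) %% 2 ^ m = \sum_(c in X :&: S) 2 ^ e c.
  by move=> sXD; rewrite sum_split // modnMDl modn_small.
have sSD : S \subset D by apply/subsetP => x; rewrite inE => /andP[].
have sBD : B \subset D by apply/subsetP => x; rewrite inE => /andP[].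
have SIB : S :&: B = set0.
  by apply/setP => x; rewrite !inE andbACA andbb ltn_neqAle; case: eqP; rewrite ?andbF.
rewrite sum_div // sum_mod // (setIidPr sBD) (setIidPr sSD).
pose PS := [set X : {set T} | X \subset S & \sum_(c in X) 2 ^ e c == k %% 2 ^ m].
pose PB := [set X : {set T} | X \subset B & #|X| == k %/ 2 ^ m].
(* [PS] has at most one element, so its cardinality equals its parity. *)
have -> : 'C(\sum_(c in S) 2 ^ e c, k %% 2 ^ m) %% 2 = #|PS|.
  rewrite -card_subset_sum_mod2 modn_small // ltnS.
  apply/card_le1_eqP => X Y; rewrite !inE => /andP[sXS /eqP eqX] /andP[sYS /eqP eqY].
  by apply: (sum_pow2_inj inj_S) => //; rewrite eqX eqY.
(* A subset of [D] corresponds to the pair of its small and large parts. *)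
rewrite -(cards_draws B) -/PB -cardsX.
have UI X Y : X \subset S -> Y \subset B ->
    ((X :|: Y) :&: S = X) /\ ((X :|: Y) :&: B = Y).
  move=> sXS sYB; rewrite !setIUl (setIidPl sXS) (setIidPl sYB).
  have -> : Y :&: S = set0 by apply/eqP; rewrite -subset0 -SIB setIC setIS.
  have -> : X :&: B = set0 by apply/eqP; rewrite -subset0 -SIB setSI.
  by rewrite setU0 set0U.
rewrite -(@card_in_imset _ _ (fun p => p.1 :|: p.2) (setX PS PB)); last first.
  move=> [X Y] [X' Y'] /=; rewrite !inE /=.
  move=> /andP[/andP[sX _] /andP[sY _]] /andP[/andP[sX' _] /andP[sY' _]] eqU.
  have [XE YE] := UI _ _ sX sY; have [XE' YE'] := UI _ _ sX' sY'.
  by congr (_, _); [rewrite -XE -XE' eqU|rewrite -YE -YE' eqU].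
congr #|pred_of_set _|; apply/setP => X; rewrite inE; apply/andP/imsetP.
  move=> [sXD /eqP sumX]; exists (X :&: S, X :&: B).
    by rewrite !inE /= !subsetIr -sum_mod // -sum_div // sumX !eqxx.
  apply/setP => x /=; rewrite !inE; case xX: (x \in X) => //=.
  have xD := subsetP sXD x xX.
  by rewrite xD /= orbC -leq_eqVlt le_em.
move=> [[Y Z]]; rewrite !inE /= => /andP[/andP[sYS /eqP sumY] /andP[sZB /eqP cardZ]] ->.
have sD : Y :|: Z \subset D by rewrite subUset (subset_trans sYS) // (subset_trans sZB).
have [YE ZE] := UI _ _ sYS sZB.
by split=> //; rewrite sum_split // YE ZE sumY cardZ -divn_eq.
Qed.

End PowerOfTwoWeights.

(** * Merging blocks in generalized Kneser graphs *)

Lemma swap_sets (T : finType) (B C : {set T}) : [disjoint B & C] -> #|B| = #|C| ->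
  exists p : T -> T, [/\ involutive p, {in B, forall x, p x \in C},
    {in C, forall x, p x \in B} & forall x, x \notin B -> x \notin C -> p x = x].
Proof.
move=> disBC eqBC; have notinB x : x \in C -> (x \in B) = false.
  exact: disjointFl disBC.
(* Elements of equal rank in the two enumerations are exchanged. *)
pose p x := if x \in B then nth x (enum C) (index x (enum B)) else
            if x \in C then nth x (enum B) (index x (enum C)) else x.
have idx (D D' : {set T}) x : #|D| = #|D'| -> x \in D -> index x (enum D) < size (enum D').
  by move=> eqD xD; rewrite -cardE -eqD cardE index_mem mem_enum.
have pB x : x \in B -> p x \in C.
  by move=> xB; rewrite /p xB -[_ \in C]mem_enum mem_nth // (idx B).
have pC x : x \in C -> p x \in B.
  by move=> xC; rewrite /p (notinB _ xC) xC -[_ \in B]mem_enum mem_nth // (idx C).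
exists p; split=> // [x|x /negbTE xB /negbTE xC]; last by rewrite /p xB xC.
case xB: (x \in B).
  rewrite {1}/p notinB ?pB // /p xB index_uniq ?enum_uniq ?(idx B) //.
  by rewrite nth_index // mem_enum.
case xC: (x \in C); last by rewrite /p xB xC xB xC.
rewrite {1}/p pC // /p xB xC index_uniq ?enum_uniq ?(idx C) //.
by rewrite nth_index // mem_enum.
Qed.

Section KneserReduction.

Variables n k l : nat.
Let V := kneser n k%:Z l%:Z.
Let m := up_log 2 (k - l).
Implicit Types (b : 'I_n -> 'I_n) (A : kneser_vertex n k%:Z).

(** A partition into blocks is encoded by the map [b] sending a point to the label of its block;
    labels outside the image have empty fibers. *)
Definition fiber b c := [set x | b x == c].

Definition saturated b : {set V} :=
  [set A : V | [forall x, forall y, (b x == b y) ==> ((x \in val A) == (y \in val A))]].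

Lemma saturatedP b (A : V) :
  reflect (forall x y, b x = b y -> (x \in val A) = (y \in val A)) (A \in saturated b).
Proof.
rewrite inE; apply: (iffP forallP) => [sat x y eqb|sat x].
  by have /forallP/(_ y) := sat x; rewrite eqb eqxx => /eqP.
by apply/forallP => y; apply/implyP => /eqP/sat->.
Qed.

Lemma card_kneser_vertex (A : V) : #|val A| = k.
Proof. by have := valP A; rewrite eqz_nat => /eqP. Qed.

Definition merge c1 c2 b : 'I_n -> 'I_n := fun x => if b x == c2 then c1 else b x.

(* If two fibers of b have the same size smaller than k - l, then a vertex that
   contains only one of them meets its image under the swap of the two fibers
   in more than l points: the swap maps no vertex to an adjacent one. *)
Lemma nim_pos_merge b c1 c2 : c1 != c2 ->
    #|fiber b c1| = #|fiber b c2| -> #|fiber b c1| < k - l ->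
  nim_pos (induced (saturated b)) = nim_pos (induced (saturated (merge c1 c2 b))).
Proof.
move=> neq_c eq_card lt_card.
have [|p [pK p1 p2 pD]] := swap_sets _ eq_card.
  rewrite -setI_eq0; apply/eqP/setP => x; rewrite !inE.
  by apply/negP => /andP[/eqP->]; apply/negP.
have b_p x : b (p x) = tperm c1 c2 (b x).
  case: tpermP => [bx|bx|/eqP nc1 /eqP nc2].
  - by have := p1 x; rewrite !inE bx eqxx => /(_ isT)/eqP.
  - by have := p2 x; rewrite !inE bx eqxx => /(_ isT)/eqP.
  - by rewrite pD ?inE.
have inj_p := inv_inj pK.
have card_p (A : V) : (#|p @^-1: val A|%:Z == k%:Z)%R.
  by rewrite card_preimset // card_kneser_vertex.
pose s (A : V) : V := Sub (p @^-1: val A) (card_p A).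
have sE A x : (x \in val (s A)) = (p x \in val A) by rewrite SubK inE.
have sK : involutive s by move=> A; apply/val_inj/setP => x; rewrite !sE pK.
rewrite (@nim_pos_induced_involution V s) //.
- congr (nim_pos (induced _)); apply/setP => A; rewrite inE.
  (* A saturated vertex is fixed by the swap exactly when it contains both blocks or neither. *)
  apply/andP/saturatedP => [[/saturatedP sat /eqP fixA] x y|sat].
    have sat' z t : b z = tperm c1 c2 (b t) -> (z \in val A) = (t \in val A).
      by rewrite -b_p => /sat->; rewrite -sE fixA.
    rewrite /merge; case: eqP => [bx|_]; case: eqP => [b_y|_].
    + by move=> _; apply: sat; rewrite bx b_y.
    + by move=> b_y; apply: sat'; rewrite bx -b_y tpermL.
    + by move=> bx; apply: sat'; rewrite bx b_y tpermR.
    + exact: sat.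
  split; first by apply/saturatedP => x y eqb; apply: sat; rewrite /merge eqb.
  apply/eqP/val_inj/setP => x; rewrite sE; apply: sat; rewrite /merge b_p.
  case: tpermP => [->|->|/eqP _ /eqP /negbTE-> //].
    by rewrite eqxx (negbTE neq_c).
  by rewrite eqxx (negbTE neq_c).
- move=> A A' /=; rewrite /kneser_adj (inj_eq (inv_inj sK)) => /andP[-> /=].
  by rewrite -preimsetI card_preimset.
- by move=> A /saturatedP sat; apply/saturatedP => x y eqb;
    rewrite !sE; apply: sat; rewrite !b_p eqb.
move=> A /saturatedP sat; rewrite /= /kneser_adj negb_and -implybE.
apply/implyP => neqA; rewrite lez_nat -ltnNge.
have [x] : exists x, x \in val A :\: val (s A).
  apply/set0Pn; rewrite setD_eq0; apply: contra neqA => sub.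
  by rewrite -val_eqE eqEcard sub !card_kneser_vertex leqnn.
case/setDP=> xA xsA.
rewrite sE in xsA.
have bpx : tperm c1 c2 (b x) != b x by rewrite -b_p; apply: contraNneq xsA => /sat->.
(* [A] contains just one of the two blocks, so the difference lies in that block and has fewer than
   [k - l] points. *)
have sub_fiber : val A :\: val (s A) \subset fiber b (b x).
  apply/subsetP => y /setDP[yA]; rewrite sE inE => pyA.
  have bpxy : tperm c1 c2 (b x) != b y by rewrite -b_p; apply: contraNneq xsA => /sat->.
  have bpy : tperm c1 c2 (b y) != b y by rewrite -b_p; apply: contraNneq pyA => /sat->.
  move: bpx bpxy bpy; do 2!case: tpermP => [->|->|_ _]; by rewrite ?eqxx.
have card_bx : #|fiber b (b x)| = #|fiber b c1|.
  by move: bpx; case: tpermP => [->|->|] //; rewrite eqxx.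
have := subset_leq_card sub_fiber; have := cardsID (val (s A)) (val A).
rewrite card_bx card_kneser_vertex; lia.
Qed.

(* Two distinct unions of fibers of the same size differ by a fiber of size 2 ^ m. *)
Lemma nim_pos_saturated_distinct b :
    (forall x, exists2 j, j <= m & #|fiber b (b x)| = 2 ^ j) ->
    (forall x y, #|fiber b (b x)| = #|fiber b (b y)| -> #|fiber b (b x)| < 2 ^ m ->
      b x = b y) ->
  nim_pos (induced (saturated b)) =
    ('C(n %% 2 ^ m, k %% 2 ^ m) %% 2) * ('C(n %/ 2 ^ m, k %/ 2 ^ m) %% 3).
Proof.
move=> pow_b inj_b; pose D := [set b x | x : 'I_n].
pose e (c : 'I_n) := logn 2 #|fiber b c|.
have eE c : c \in D -> #|fiber b c| = 2 ^ e c.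
  by case/imsetP=> x _ ->; rewrite /e; have [j _ ->] := pow_b x; rewrite pfactorK.
have e_le : {in D, forall c, e c <= m}.
  by move=> _ /imsetP[x _ ->]; rewrite /e; have [j le_j ->] := pow_b x; rewrite pfactorK.
have e_inj : {in D &, forall c c', e c = e c' -> e c < m -> c = c'}.
  move=> c c' cD c'D eq_e lt_e; have := eE c cD; have := eE c' c'D.
  case/imsetP: cD lt_e eq_e => x _ ->; case/imsetP: c'D => y _ -> lt_e eq_e ey ex.
  by apply: inj_b; rewrite ?ex ?ey ?eq_e // -eq_e ltn_exp2l.
pose U (X : {set 'I_n}) := [set x | b x \in X].
have cardU (X : {set 'I_n}) : X \subset D -> #|U X| = \sum_(c in X) 2 ^ e c.
  move=> sXD; rewrite -sum1_card (partition_big b (mem X)) /= => [|x]; last by rewrite inE.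
  apply: eq_bigr => c cX; rewrite -eE ?(subsetP sXD) // -sum1_card.
  by apply: eq_bigl => x; rewrite !inE andbC; case: eqP => [->|].
(* [L] and [U] match saturated vertices with the sets of labels in [D] of total weight [k]. *)
pose L (A : V) : {set 'I_n} := b @: val A.
have UL (A : V) : A \in saturated b -> U (L A) = val A.
  move=> /saturatedP sat; apply/setP => x; rewrite inE; apply/imsetP/idP.
    by case=> y yA /sat->.
  by exists x.
have LD (A : V) : L A \subset D by apply/subsetP => _ /imsetP[x _ ->]; apply: imset_f.
have L_inj : {in saturated b &, injective L}.
  by move=> A A' satA satA' eqL; apply: val_inj; rewrite -UL // eqL UL.
have sumL (A : V) : A \in saturated b -> \sum_(c in L A) 2 ^ e c = k.
  by move=> satA; rewrite -cardU // UL // card_kneser_vertex.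
have nE : \sum_(c in D) 2 ^ e c = n.
  rewrite -cardU // -[RHS]card_ord -cardsT; congr #|pred_of_set _|.
  by apply/setP => x; rewrite !inE imset_f.
rewrite nim_pos_clique.
  have := card_subset_sum k e_le e_inj; rewrite /= nE.
  set N := #|_| => NE; suff -> : #|saturated b| = N.
    (* The first factor is 0 or 1, so reduction modulo 3 only affects the second. *)
    rewrite NE modn2; case: odd; last by rewrite !mul0n.
    by rewrite !mul1n.
  rewrite -(card_in_imset L_inj) /N; congr #|pred_of_set _|; apply/setP => X.
  rewrite inE; apply/imsetP/andP => [[A satA ->]|[sXD /eqP sumX]].
    by rewrite LD sumL.
  have cardX : (#|U X|%:Z == k%:Z)%R by rewrite cardU // sumX.
  exists (Sub (U X) cardX : V).
    by apply/saturatedP => x y eqb; rewrite SubK !inE eqb.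
  rewrite /L SubK; apply/setP => c; apply/idP/imsetP => [cX|[x]]; last first.
    by rewrite inE => xX ->.
  by have /imsetP[x _ cx] := subsetP sXD c cX; exists x; rewrite // inE -cx.
move=> A A' satA satA' neqA; rewrite /= /kneser_adj neqA lez_nat /=.
rewrite -[sval A]/(val A) -[sval A']/(val A').
have le_m : k - l <= 2 ^ m by rewrite up_logP.
suff : 2 ^ m <= #|val A :\: val A'|.
  move: le_m (cardsID (val A') (val A)); rewrite card_kneser_vertex.
  move: #|_ :&: _| #|_ :\: _| (2 ^ m) => i d q; lia.
have cardUD (X Y : {set 'I_n}) : #|U X :\: U Y| = #|U (X :\: Y)|.
  by congr #|pred_of_set _|; apply/setP => x; rewrite !inE.
have eq_cardD : #|val A :\: val A'| = #|val A' :\: val A|.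
  have := cardsID (val A') (val A); have := cardsID (val A) (val A').
  by rewrite !card_kneser_vertex setIC; lia.
have sDD (X Y : {set 'I_n}) : X \subset D -> X :\: Y \subset D.
  by apply: subset_trans; apply: subsetDl.
have big (X Y : {set 'I_n}) c : X \subset D -> c \in X :\: Y -> m <= e c -> 2 ^ m <= #|U X :\: U Y|.
  move=> sXD cXY le_mc; rewrite cardUD cardU ?sDD // (big_setD1 c) //=.
  by rewrite (leq_trans _ (leq_addr _ _)) // leq_exp2l.
(* If either difference contains a block of size [2 ^ m], the bound holds. Otherwise both consist of
   small blocks of distinct sizes with equal total, and uniqueness of binary expansions gives
   [A = A']. *)
have [/existsP[c /andP[cS le_mc]]|/existsPn small] :=
  boolP [exists c, (c \in L A :\: L A') && (m <= e c)].
  by rewrite -UL // -(UL A') //; apply: (big _ _ c).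
have [/existsP[c /andP[cS le_mc]]|/existsPn small'] :=
  boolP [exists c, (c \in L A' :\: L A) && (m <= e c)].
  by rewrite eq_cardD -UL // -(UL A) //; apply: (big _ _ c).
pose S := [set c in D | e c < m].
have inj_S : {in S &, injective e}.
  move=> x y; rewrite !inE => /andP[xD lt_x] /andP[yD _] eq_e.
  exact: e_inj.
have sub_S (X Y : {set 'I_n}) : X \subset D ->
    (forall c, ~~ ((c \in X :\: Y) && (m <= e c))) -> X :\: Y \subset S.
  move=> sXD sm; apply/subsetP => c cXY; have := sm c.
  by rewrite cXY /= -ltnNge inE => ->; rewrite (subsetP (sDD X Y sXD)).
have eqD : L A :\: L A' = L A' :\: L A.
  apply: (sum_pow2_inj inj_S); rewrite ?sub_S //.
  by rewrite -!cardU ?sDD // -!cardUD !UL.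
case/eqP: neqA; apply: L_inj => //; apply/setP => c.
by have /setP/(_ c) := eqD; rewrite !inE; do 2!case: (c \in _).
Qed.

(** By induction on the number of blocks: merging two equal blocks smaller than [2 ^ m] doubles
    their size, which stays a power of two at most [2 ^ m]. *)
Lemma nim_pos_saturated b : l < k ->
    (forall x, exists2 j, j <= m & #|fiber b (b x)| = 2 ^ j) ->
  nim_pos (induced (saturated b)) =
    ('C(n %% 2 ^ m, k %% 2 ^ m) %% 2) * ('C(n %/ 2 ^ m, k %/ 2 ^ m) %% 3).
Proof.
move=> lt_lk; have [N] := ubnP #|[set b x | x : 'I_n]|.
elim: N b => // N IHN b ltN pow_b.
have [/existsP[x /existsP[y /and3P[neq_b /eqP eq_card lt_card]]]|no_pair] :=
  boolP [exists x, exists y, [&& b x != b y,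
    #|fiber b (b x)| == #|fiber b (b y)| & #|fiber b (b x)| < 2 ^ m]]; last first.
  apply: nim_pos_saturated_distinct => // x y eq_card lt_card; apply/eqP.
  apply: contraNT no_pair => neq_b; apply/existsP; exists x; apply/existsP; exists y.
  by rewrite neq_b eq_card eqxx -eq_card.
have [j le_jm cardj] := pow_b x.
have lt_jm : j < m by rewrite -(ltn_exp2l _ _ (isT : 1 < 2)) -cardj.
rewrite (nim_pos_merge neq_b eq_card); last first.
  (* If [k - l] were 1, then [m = 0] and no block could be smaller than [2 ^ m]. Hence
     [2 ^ (m - 1) < k - l], and blocks of size [2 ^ j] with [j < m] may be swapped. *)
  have lt1 : 1 < k - l.
    rewrite ltnNge; apply: contraL lt_jm => le1.
    by rewrite -leqNgt (_ : m = 0) //; apply/eqP; rewrite up_log_eq0 le1 orbT.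
  apply: leq_ltn_trans (up_log_gtn (isT : 1 < 2) lt1).
  by rewrite cardj leq_exp2l // -/m; lia.
set b' := merge _ _ _.
have fib1 : #|fiber b' (b x)| = 2 ^ j.+1.
  have -> : fiber b' (b x) = fiber b (b x) :|: fiber b (b y).
    apply/setP => z; rewrite !inE /b' /merge.
    by case: (eqVneq (b z) (b y)) => _; rewrite ?eqxx ?orbT ?orbF.
  rewrite cardsU -eq_card cardj expnS mul2n addnn.
  rewrite (_ : _ :&: _ = set0) ?cards0 ?subn0 //; apply/setP => z; rewrite !inE.
  by apply/negP => /andP[/eqP->]; apply/negP.
apply: IHN => [|z].
  rewrite -ltnS (leq_trans _ ltN) // ltnS; apply/proper_card/properP; split.
    apply/subsetP => _ /imsetP[z _ ->]; rewrite /b' /merge.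
    by case: ifP => _; apply: imset_f.
  exists (b y); first exact: imset_f.
  apply/imsetP => -[z _]; rewrite /b' /merge; case: eqP => [_ /eqP|/nesym //].
  by rewrite eq_sym; apply/negP.
have [->|neq1] := eqVneq (b' z) (b x); first by exists j.+1.
have neq2 : b z != b y.
  by apply: contra neq1; rewrite /b' /merge => ->.
have b'z : b' z = b z by rewrite /b' /merge (negbTE neq2).
have [i le_im cardi] := pow_b z; exists i => //; rewrite b'z -cardi.
congr #|pred_of_set _|; apply/setP => t; rewrite !inE /b' /merge.
case: (eqVneq (b t) (b y)) => [->|//].
by rewrite [b y == _]eq_sym (negbTE neq2) eq_sym -b'z (negbTE neq1).
Qed.

End KneserReduction.

Theorem theorem2p3 (n k l : nat) (hlk : l < k) :
  let m := up_log 2 (k - l) in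
  nim (graph_poset (kneser n k%:Z l%:Z)) =
    ('C(n %% 2 ^ m, k %% 2 ^ m) %% 2) * ('C(n %/ 2 ^ m, k %/ 2 ^ m) %% 3).
Proof.
(* The reduction starts from singleton blocks, for which every vertex is saturated. *)
rewrite /= -(@nim_pos_saturated n k l id) // => [|x]; last first.
  exists 0 => //; rewrite expn0 -(cards1 x); congr #|pred_of_set _|.
  by apply/setP => y; rewrite !inE.
congr nim_pos; apply/setP => F; rewrite !inE; symmetry.
by apply/subsetP => A _; apply/saturatedP => x y ->.
Qed.
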